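(* Let $G$ be a finite graph and let $k$ be an integer with $k\ge\omega(G)$. Let $kG$ denote the disjoint union of $k$ copies of $G$. Then $Z_f(kG)=\chi_f(kG)=\chi_f(G)$.
   Context: $\omega(G)$ is the maximum size of a clique of $G$. A fractional coloring of $G$ is an assignment of nonnegative real weights to the independent sets of $G$ such that for every vertex $v$ the total weight of the independent sets containing $v$ is at least $1$; $\chi_f(G)$ is the minimum total weight of a fractional coloring. A fractional cocoloring is defined the same way but weights are assigned to cliques and independent sets, with each vertex covered by total weight at least $1$; $Z_f(G)$ is the minimum total weight of a fractional cocoloring. *)

(* Defs.v *)
From HB Require Import structures.
From mathcomp Require Import all_boot all_order all_algebra.
From mathcomp Require Import all_classical all_reals all_analysis.

Set Implicit Arguments.
Unset Strict Implicit.
Unset Printing Implicit Defensive.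

Import Order.TTheory GRing.Theory Num.Theory.
Import numFieldNormedType.Exports.

Local Open Scope classical_set_scope.
Local Open Scope ring_scope.

Record sgraph := SGraph {
  vertex :> finType;
  adj : rel vertex;
  adj_sym : symmetric adj;
  adj_irrefl : irreflexive adj
}.

Section Graph.
Variable G : sgraph.
Implicit Type S : {set G}.

Definition clique S : bool :=
  [forall x in S, forall y in S, (x != y) ==> adj x y].

Definition indep S : bool :=
  [forall x in S, forall y in S, ~~ adj x y].

Definition omega : nat := \max_(S : {set G} | clique S) #|S|.

End Graph.

Section Copies.
Variables (k : nat) (G : sgraph).

Definition copies_adj : rel ('I_k * G)%type :=
  fun u v => (u.1 == v.1) && adj u.2 v.2.

Lemma copies_adj_sym : symmetric copies_adj.
Proof. by move=> u v; rewrite /copies_adj eq_sym adj_sym. Qed.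

Lemma copies_adj_irrefl : irreflexive copies_adj.
Proof. by move=> u; rewrite /copies_adj adj_irrefl andbF. Qed.

Definition copies : sgraph := SGraph copies_adj_sym copies_adj_irrefl.

End Copies.

Section Fractional.
Variable R : realType.

(* The default value 0 is taken only when A has no least element. *)
Definition minimum (A : set R) : R := xget 0 [set x | A x /\ lbound A x].

Section Cover.
Variables (G : sgraph) (F : pred {set G}).
Implicit Type w : {set G} -> R.

(* The weights live on the members of F: the values of w outside F are
   irrelevant both here and in total_weight. *)
Definition frac_cover w : Prop :=
  (forall S, F S -> 0 <= w S) /\
  (forall v : G, 1 <= \sum_(S : {set G} | F S && (v \in S)) w S).

Definition total_weight w : R := \sum_(S : {set G} | F S) w S.

End Cover.

Section Numbers.
Variable G : sgraph.

Definition frac_coloring : ({set G} -> R) -> Prop := frac_cover (@indep G).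

Definition frac_cocoloring : ({set G} -> R) -> Prop :=
  frac_cover [pred S | clique S || indep S].

Definition chi_f : R :=
  minimum [set total_weight (@indep G) w | w in frac_coloring].

Definition Z_f : R :=
  minimum [set total_weight [pred S | clique S || indep S] w
          | w in frac_cocoloring].

End Numbers.

(* The minima defining chi_f and Z_f are attained. *)

Lemma indep1 (G : sgraph) (v : G) : indep [set v]%SET.
Proof.
apply/'forall_implyP => x /set1P ->; apply/'forall_implyP => y /set1P ->.
by rewrite adj_irrefl.
Qed.

Lemma sum_continuous_rV (n : nat) (I : finType) (P : pred I) (h : I -> 'I_n) :
  continuous (fun M : 'rV[R]_n => \sum_(i | P i) M ord0 (h i)).
Proof.
move=> M.
have -> : (fun N : 'rV[R]_n => \sum_(i | P i) N ord0 (h i)) =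
          \sum_(i | P i) (fun N : 'rV[R]_n => N ord0 (h i)).
  by apply/funext => N; rewrite fct_sumE.
apply: (big_ind (fun f : 'rV[R]_n -> R => {for M, continuous f})).
- exact: cst_continuous.
- by move=> f g cf cg; exact: continuousD.
- by move=> i _; exact: coord_continuous.
Qed.

Lemma frac_cover_min (G : sgraph) (F : pred {set G}) :
    (forall v : G, F [set v]%SET) ->
  exists2 w, frac_cover F w &
    forall w', frac_cover F w' -> total_weight F w <= total_weight F w'.
Proof.
move=> F1; pose n := #|{set G}|.
pose wt (M : 'rV[R]_n) (S : {set G}) := M ord0 (enum_rank S).
pose box := [set M : 'rV[R]_n | forall i, `[0, 1]%classic (M ord0 i)].
pose C := [set M : 'rV[R]_n | forall v : G,
  1 <= \sum_(S : {set G} | F S && (v \in S)) wt M S].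
have boxc : compact box.
  apply: (@rV_compact R n (fun=> `[0, 1]%classic)) => i.
  exact: segment_compact.
have Cc : closed C.
  have -> : C = \bigcap_(v in [set: G]) ((fun M : 'rV[R]_n =>
      \sum_(S : {set G} | F S && (v \in S)) wt M S) @^-1` [set x | 1 <= x]).
    by apply/seteqP; split => [M CM v _|M CM v]; [exact: CM|exact: (CM v I)].
  apply: closed_bigI => v _; apply: closed_comp; last exact: closed_ge.
  by move=> M _; exact: sum_continuous_rV.
have K0 : (box `&` C) !=set0.
  exists (const_mx 1); split => [i|v] /=.
    by rewrite mxE in_itv /= ler01 lexx.
  rewrite (bigD1 [set v]%SET) /=; last by rewrite F1 set11.
  rewrite {1}/wt mxE lerDl; apply: sumr_ge0 => S _.
  by rewrite /wt mxE ler01.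
have Kc : compact (box `&` C) by exact: compact_closedI.
have fc : {within box `&` C, continuous (fun M => total_weight F (wt M))}.
  by apply: continuous_subspaceT; exact: sum_continuous_rV.
have [M] := compact_EVT_min K0 Kc fc.
rewrite inE => -[bM CM] minM; exists (wt M).
  split=> // S _; have := bM (enum_rank S).
  by rewrite /= in_itv /= => /andP[].
move=> w [w0 w1]; pose N : 'rV[R]_n := \row_i (
  if F (enum_val i) then Num.min 1 (w (enum_val i)) else 0).
have NE S : F S -> wt N S = Num.min 1 (w S).
  by move=> FS; rewrite /wt mxE enum_rankK FS.
have N0 S : 0 <= wt N S.
  by rewrite /wt mxE enum_rankK; case: ifP => // /w0 wS; rewrite le_min ler01.
have /minM/le_trans : N \in box `&` C.
  rewrite inE; split=> [i|v] /=.
    rewrite in_itv /= mxE; case: ifP => [/w0 wi|_]; last by rewrite lexx ler01.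
    by rewrite le_min ler01 wi ge_min lexx.
  have [[S /andP[/andP[FS vS] wS]]|big] := pselect (exists S : {set G},
      F S && (v \in S) && (1 <= w S)).
    rewrite (bigD1 S) /=; last by rewrite FS vS.
    by rewrite NE// min_l// lerDl; apply: sumr_ge0 => T _; exact: N0.
  rewrite (le_trans (w1 v))//; apply: ler_sum => S /andP[FS vS].
  rewrite NE// le_min lexx andbT leNgt; apply/negP => wS; apply: big.
  by exists S; rewrite FS vS ltW.
apply; apply: ler_sum => S FS.
by rewrite NE// ge_min lexx orbT.
Qed.

Lemma minimum_frac_cover (G : sgraph) (F : pred {set G}) :
    (forall v : G, F [set v]%SET) ->
  let A := [set total_weight F w | w in frac_cover F] in
  A (minimum A) /\ lbound A (minimum A).
Proof.
move=> F1 A; rewrite /minimum.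
apply: (@xgetPex _ 0 [set x | A x /\ lbound A x]).
have [w cw minw] := frac_cover_min F1.
exists (total_weight F w); split; first by exists w.
by move=> _ [w' cw' <-]; exact: minw.
Qed.

Lemma chi_fP (G : sgraph) :
  (exists2 w, frac_coloring w & total_weight (@indep G) w = chi_f G) /\
  (forall w, frac_coloring w -> chi_f G <= total_weight (@indep G) w).
Proof.
have [[w cw wE] lb] := minimum_frac_cover (@indep1 G).
by split; [exists w|move=> w' cw'; apply: lb; exists w'].
Qed.

Lemma Z_fP (G : sgraph) :
  (exists2 w, frac_cocoloring w &
    total_weight [pred S : {set G} | clique S || indep S] w = Z_f G) /\
  (forall w, frac_cocoloring w ->
    Z_f G <= total_weight [pred S : {set G} | clique S || indep S] w).
Proof.
have F1 (v : G) : [pred S : {set G} | clique S || indep S] [set v]%SET.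
  by rewrite /= indep1 orbT.
have [[w cw wE] lb] := minimum_frac_cover F1.
by split; [exists w|move=> w' cw'; apply: lb; exists w'].
Qed.

End Fractional.

(* Main.v *)
Require Import Defs.
From mathcomp Require Import all_boot all_order all_algebra.
From mathcomp Require Import all_classical all_reals all_analysis.

(** A fractional coloring of G, pulled back along the projection kG -> G, colors
    kG at the same cost.  Conversely, restrict a fractional cocoloring of kG to
    the i-th copy of G and replace each clique by its vertices, with the same
    weight: this is a fractional coloring of G.  A clique K of kG lies in a
    single copy and has at most omega(G) <= k vertices, so in the sum of the k
    resulting weights every K is counted at most k times, as is every
    independent set.  Hence k * chi_f(G) <= k * Z_f(kG). *)

Set Implicit Arguments.
Unset Strict Implicit.
Unset Printing Implicit Defensive.

Import Order.TTheory GRing.Theory Num.Theory.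

Local Open Scope ring_scope.

Lemma leq_card_omega (G : sgraph) (S : {set G}) :
  clique S -> (#|S| <= omega G)%N.
Proof. by move=> cS; rewrite /omega (bigD1 S) //= leq_maxl. Qed.

Lemma omega_gt0 (G : sgraph) (v : G) : (0 < omega G)%N.
Proof.
rewrite -(cards1 v); apply: leq_card_omega.
apply/'forall_implyP => x /set1P ->; apply/'forall_implyP => y /set1P ->.
by rewrite eqxx.
Qed.

(** Two distinct vertices of a clique of [copies k G] have adjacent, hence distinct, second
    components. So the projection to [G] is injective on [K], and its image is a clique. *)
Lemma leq_card_clique_copies (k : nat) (G : sgraph) (K : {set copies k G}) :
  clique K -> (#|K| <= omega G)%N.
Proof.
move=> /'forall_implyP cK.
have adjK x y : x \in K -> y \in K -> x != y -> adj x.2 y.2.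
  by move=> /cK/'forall_implyP/[apply]/implyP/[apply]/andP[].
rewrite -(@card_in_imset _ _ (fun u : copies k G => u.2 : G)); last first.
  move=> x y xK yK xy; apply/eqP/negPn/negP => /(adjK _ _ xK yK).
  by rewrite xy adj_irrefl.
apply: leq_card_omega.
apply/'forall_implyP => _ /imsetP[x xK ->].
apply/'forall_implyP => _ /imsetP[y yK ->].
by apply/implyP => xy; apply: adjK => //; apply: contraNneq xy => ->.
Qed.

Section FractionalCovers.
Variable R : realType.

(** Lets covers be given as weighted families in which a set may occur several times: each set
    receives the total weight of its fiber under [f]. *)
Lemma frac_cover_family (G : sgraph) (F : pred {set G}) (I : finType)
    (P : pred I) (f : I -> {set G}) (a : I -> R) :
    (forall i, P i -> F (f i)) -> (forall i, P i -> 0 <= a i) ->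
    (forall v, 1 <= \sum_(i | P i && (v \in f i)) a i) ->
  exists2 w, frac_cover F w & total_weight F w = \sum_(i | P i) a i.
Proof.
move=> Ff a0 a1; exists (fun S => \sum_(i | P i && (f i == S)) a i).
  split=> [S _|v]; first by apply: sumr_ge0 => i /andP[/a0].
  rewrite (le_trans (a1 v))// (partition_big f [pred S | F S && (v \in S)]) /=.
    rewrite le_eqVlt; apply/orP; left; apply/eqP.
    apply: eq_bigr => S /andP[_ vS]; apply: eq_bigl => i.
    by case: eqP => [->|]; rewrite ?vS ?andbT ?andbF.
  by move=> i /andP[/Ff -> ->].
by rewrite /total_weight [RHS](partition_big f F).
Qed.

Lemma chi_f_le_family (G : sgraph) (I : finType)
    (P : pred I) (f : I -> {set G}) (a : I -> R) :
    (forall i, P i -> indep (f i)) -> (forall i, P i -> 0 <= a i) ->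
    (forall v, 1 <= \sum_(i | P i && (v \in f i)) a i) ->
  chi_f R G <= \sum_(i | P i) a i.
Proof.
move=> If a0 a1; have [w cw <-] := frac_cover_family If a0 a1.
by have [_] := chi_fP R G; apply.
Qed.

Lemma Z_f_le_chi_f (G : sgraph) : Z_f R G <= chi_f R G.
Proof.
have [[w [w0 w1] <-] _] := chi_fP R G; have [_ minZ] := Z_fP R G.
(* Off the independent sets [w] is arbitrary, possibly negative. Taking the family [id] over the
   independent sets replaces those values by 0. *)
have IF (S : {set G}) : indep S -> [pred S | clique S || indep S] (id S).
  by move=> /= ->; rewrite orbT.
have [w' cw' wE] := frac_cover_family IF w0 w1.
by rewrite {1}/total_weight -wE; exact: minZ.
Qed.

Lemma Z_f_ge0 (G : sgraph) : 0 <= Z_f R G.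
Proof. by have [[w [w0 _] <-] _] := Z_fP R G; apply: sumr_ge0. Qed.

Lemma chi_f_copies_le (k : nat) (G : sgraph) :
  chi_f R (copies k G) <= chi_f R G.
Proof.
have [[w [w0 w1] <-] _] := chi_fP R G.
rewrite /total_weight.
have := @chi_f_le_family (copies k G) _ (@indep G)
  (fun S => [set u : copies k G | u.2 \in S]%SET) w.
apply => // [S|[i v]].
  move=> /'forall_implyP iS; apply/'forall_implyP => x; rewrite inE => xS.
  apply/'forall_implyP => y; rewrite inE => yS.
  by have /'forall_implyP/(_ _ yS) := iS _ xS; apply: contra => /andP[].
rewrite (le_trans (w1 v))// le_eqVlt; apply/orP; left; apply/eqP.
by apply: eq_bigl => S; rewrite inE.
Qed.

(** Sets that are both cliques and independent stay whole; only the remaining cliques are broken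
    into singletons. *)
Lemma chi_f_le_copy (k : nat) (G : sgraph) (w : {set copies k G} -> R)
    (i : 'I_k) :
    frac_cocoloring w ->
  chi_f R G <= \sum_(S : {set copies k G} | indep S) w S +
    \sum_(K : {set copies k G} | clique K && ~~ indep K)
      \sum_(v : G | (i, v) \in K) w K.
Proof.
move=> [w0 w1].
(* [inl T] stands for the trace of an independent set [T] on copy [i], and [inr (K, v)] for the
   singleton of one vertex [v] in the trace of a clique [K]. *)
pose P (s : {set copies k G} + {set copies k G} * G) := match s with
  | inl T => indep T
  | inr (K, v) => (clique K && ~~ indep K) && ((i, v) \in K) end.
pose f (s : {set copies k G} + {set copies k G} * G) : {set G} := match s with
  | inl T => [set v | (i, v) \in T]%SET
  | inr (_, v) => [set v]%SET end.
pose a (s : {set copies k G} + {set copies k G} * G) := match s with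
  | inl T => w T
  | inr (K, _) => w K end.
rewrite pair_big_dep.
have <- : \sum_(s | P s) a s = \sum_(S | indep S) w S +
    \sum_(p : {set copies k G} * G |
      (clique p.1 && ~~ indep p.1) && ((i, p.2) \in p.1)) w p.1.
  by rewrite big_sumType; congr (_ + _); apply: eq_big => -[].
apply: (@chi_f_le_family _ _ P f).
- case=> [S /'forall_implyP iS|[K v] _]; last exact: indep1.
  apply/'forall_implyP => x; rewrite inE => xS.
  apply/'forall_implyP => y; rewrite inE => yS.
  have /'forall_implyP/(_ _ yS) := iS _ xS.
  by rewrite /= /copies_adj /= eqxx.
- case=> [S /= iS|[K v] /andP[/andP[cK _] _]]; apply: w0 => /=.
    by rewrite iS orbT.
  by rewrite cK.
move=> v; apply: le_trans (w1 (i, v)) _.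
rewrite big_sumType (bigID (@indep (copies k G))) /=; apply: lerD.
  rewrite le_eqVlt; apply/orP; left; apply/eqP; apply: eq_bigl => S.
  by rewrite inE; case: indep; rewrite ?orbT ?andbF ?andbT.
rewrite le_eqVlt; apply/orP; left; apply/eqP; symmetry.
(* Among the singletons coming from [K], only that of [v] itself covers [v], so the pairs reduce to
   the cliques through [(i, v)]. *)
rewrite (reindex_onto (fun K => (K, v)) (fun p => p.1)) /=; last first.
  by move=> [K u] /andP[_]; move=> /set1P ->.
apply: eq_bigl => K; rewrite inE !eqxx !andbT.
by case: indep; rewrite ?andbF ?orbF ?andbT.
Qed.

End FractionalCovers.

Theorem theorem3 (R : realType) (G : sgraph) (k : nat) (hk : (omega G <= k)%N) :
  Z_f R (copies k G) = chi_f R (copies k G) /\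
  chi_f R (copies k G) = chi_f R G.
Proof.
have ZC := Z_f_le_chi_f R (copies k G).
have CC := chi_f_copies_le R k G.
suff CZ : chi_f R G <= Z_f R (copies k G).
  split; apply/le_anti; rewrite ?ZC ?CC /=; first exact: le_trans CZ.
  exact: le_trans ZC.
(* For empty [G], [k] may be 0 and cannot be cancelled; there the empty family of sets gives
   [chi_f R G <= 0]. *)
have [G0|/card_gt0P[v _]] := posnP #|G|.
  apply: le_trans (Z_f_ge0 R (copies k G)).
  have := @chi_f_le_family R G G pred0 (fun v => [set v]%SET) (fun=> 0).
  rewrite big_pred0//; apply=> // v.
  by have := card0_eq G0 v; rewrite inE.
have k0 : (0 < k)%N := leq_trans (omega_gt0 v) hk.
have [[w cw <-] _] := Z_fP R (copies k G).
rewrite -(ler_pMn2r k0).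
have -> : chi_f R G *+ k = \sum_(i < k) chi_f R G.
  by rewrite sumr_const card_ord.
rewrite (le_trans (ler_sum _ (fun i _ => chi_f_le_copy i cw)))//.
rewrite big_split /= sumr_const card_ord.
rewrite /total_weight [X in _ <= X *+ _](bigID (@indep (copies k G))) /= mulrnDl.
(* The independent sets contribute equally to both sides, [k] times each; the inequality comes from
   the other cliques. *)
apply: lerD.
  rewrite le_eqVlt; apply/orP; left; apply/eqP; congr (_ *+ _).
  by apply: eq_bigl => S; case: indep; rewrite ?orbT ?andbF.
rewrite exchange_big /= -sumrMnl.
have cliqueD (K : {set copies k G}) :
    (clique K || indep K) && ~~ indep K = clique K && ~~ indep K.
  by case: indep; rewrite ?andbF ?orbF.
rewrite (eq_bigl _ _ cliqueD).
apply: ler_sum => K /andP[cK _].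
(* Over all copies, [w K] is added once for each vertex [(i, v)] of [K], that is [#|K|] times, and
   [#|K| <= omega G <= k]. *)
rewrite (pair_big_dep xpredT (fun i v => (i, v) \in K) (fun _ _ => w K)) /=.
rewrite sumr_const.
rewrite ler_wpMn2l//; first by case: cw => w0 _; apply: w0; rewrite /= cK.
rewrite (leq_trans _ hk)// (leq_trans _ (leq_card_clique_copies cK))//.
by apply: subset_leq_card; apply/fintype.subsetP => -[].
Qed.
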